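(* Let $n\ge 1$ and let $D$ be a locally finite $\mathbb{C}$-derivation of $\mathbb{C}[X_1,\ldots,X_n]$ which is homogeneous of degree $k\neq 0$ with respect to some monomial grading. Then $\exp(D)$ is shifted linearizable.
   Context: A $\mathbb{C}$-derivation $D$ of $A=\mathbb{C}[X_1,\ldots,X_n]$ is locally finite if for every $a\in A$ the $\mathbb{C}$-span of $a,D(a),D^2(a),\ldots$ is finite dimensional; then $\exp(D)=\sum_{i\ge 0}\frac{1}{i!}D^i$ is a well-defined $\mathbb{C}$-algebra automorphism of $A$. A monomial grading on $A$ is a grading for which each monomial (equivalently each variable $X_i$) is homogeneous; it is determined by the weights $w_i=\deg(X_i)$, taken in $\mathbb{R}$ (this includes weights in $\mathbb{N}$ or $\mathbb{Z}$), the monomial $X_1^{v_1}\cdots X_n^{v_n}$ having degree $\sum_i v_iw_i$. A derivation $D$ is homogeneous of degree $k$ if it sends every homogeneous element of degree $d$ to a homogeneous element of degree $d+k$ or to $0$. $\mathrm{GA}_n(\mathbb{C})$ is the group of polynomial automorphisms, i.e. of $\mathbb{C}$-algebra automorphisms of $A$, where an automorphism is written as the tuple $(F_1,\ldots,F_n)$ of images of $X_1,\ldots,X_n$. $\mathrm{GL}_n(\mathbb{C})\subset \mathrm{GA}_n(\mathbb{C})$ is the subgroup of linear automorphisms (each $X_i$ is sent to a linear form). $F\in\mathrm{GA}_n(\mathbb{C})$ is linearizable if there exist $G\in\mathrm{GA}_n(\mathbb{C})$ and $L'\in\mathrm{GL}_n(\mathbb{C})$ with $G^{-1}FG=L'$.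 $F$ is shifted linearizable if there exists $L\in\mathrm{GL}_n(\mathbb{C})$ such that $LF$ is linearizable. *)

(* Defs.v *)
From HB Require Import structures.
From mathcomp Require Import all_boot all_order all_algebra.
From mathcomp Require Import complex.
From mathcomp Require Import all_classical all_reals all_analysis.
(* The notations of mpoly clash with those of mathcomp-analysis; hence
   [mpoly n K] is written for K[X_1, ..., X_n], [mpolyX K (mnm1 i)] for the
   variable X_i and [mcoeff m p] for the coefficient of the monomial m in p. *)
From mathcomp Require Import -(notations) mpoly.

Set Implicit Arguments.
Unset Strict Implicit.
Unset Printing Implicit Defensive.

Import Order.TTheory GRing.Theory Num.Theory.
Import numFieldNormedType.Exports.

Local Open Scope classical_set_scope.
Local Open Scope ring_scope.

Section LocallyFinite.
Variables (K : fieldType) (V : lmodType K).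

Definition lspan (S : set V) : set V :=
  [set p | exists (r : nat) (c : 'I_r -> K) (v : 'I_r -> V),
     (forall j, S (v j)) /\ p = \sum_(j < r) c j *: v j].

Definition finite_dimensional (W : set V) : Prop :=
  exists (r : nat) (b : 'I_r -> V), W = lspan (range b).

Definition locally_finite (D : V -> V) : Prop :=
  forall a : V, finite_dimensional (lspan (range (fun i : nat => iter i D a))).

End LocallyFinite.

Definition derivation (K : fieldType) (A : algType K) (D : A -> A) : Prop :=
  linear D /\ (forall p q : A, D (p * q) = D p * q + p * D q).

Section MonomialGrading.
Variables (R : numDomainType) (K : fieldType) (n : nat) (w : 'I_n -> R).

Definition wdegree (m : multinom n) : R := \sum_(i < n) (m i)%:R * w i.

(* The zero polynomial satisfies this for every d. *)
Definition whomogeneous (d : R) (p : mpoly n K) : Prop :=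
  forall m, m \in msupp p -> wdegree m = d.

Definition homogeneous_of_degree (k : R) (D : mpoly n K -> mpoly n K) : Prop :=
  forall (d : R) (p : mpoly n K),
    whomogeneous d p -> whomogeneous (d + k) (D p).

End MonomialGrading.

Section Exponential.
Variables (K : numFieldType) (n : nat).

(* The series is summed coefficientwise. If D is locally finite, its partial
   sums lie in the finite dimensional span of the iterates D^i(a), on which
   coefficientwise convergence is convergence for the unique Hausdorff vector
   space topology; the limit is unique, and the default value 0 of xget is
   only used when no limit exists. *)
Definition exp_derivation (D : mpoly n K -> mpoly n K) (a : mpoly n K) :
    mpoly n K :=
  xget 0 [set b : mpoly n K | forall m : multinom n,
    series (fun i : nat => (i`!%:R)^-1 * mcoeff m (iter i D a) : K) @ \oo
      --> mcoeff m b].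

End Exponential.

Section PolynomialAutomorphisms.
Variables (K : fieldType) (n : nat).
Local Notation A := (mpoly n K).

(* Automorphisms are composed as maps A -> A. Composing the tuples
   (F_1, ..., F_n) as polynomial maps instead reverses products; this changes
   neither linearizability nor shifted linearizability, since
   LF = L(FL)L^-1. *)
Definition GA (F : A -> A) : Prop :=
  [/\ linear F, GRing.monoid_morphism F & bijective F].

Definition GL (F : A -> A) : Prop :=
  GA F /\ forall i : 'I_n, exists c : 'I_n -> K,
    F (mpolyX K (mnm1 i)) = \sum_(j < n) c j *: mpolyX K (mnm1 j).

Definition linearizable (F : A -> A) : Prop :=
  GA F /\ exists G Ginv L' : A -> A,
    [/\ GA G, cancel G Ginv, cancel Ginv G, GL L' & Ginv \o F \o G =1 L'].

Definition shifted_linearizable (F : A -> A) : Prop :=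
  GA F /\ exists L : A -> A, GL L /\ linearizable (L \o F).

End PolynomialAutomorphisms.

(* Main.v *)
Require Import Defs.
From HB Require Import structures.
From mathcomp Require Import all_boot all_order all_algebra.
From mathcomp Require Import complex.
From mathcomp Require Import all_classical all_reals all_analysis.
From mathcomp Require Import -(notations) mpoly.
From mathcomp Require Import ring.
Import numFieldNormedType.Exports.

Set Implicit Arguments.
Unset Strict Implicit.
Unset Printing Implicit Defensive.

Import Order.TTheory GRing.Theory Num.Theory.
Local Open Scope ring_scope.

(** Since D shifts degrees by k <> 0, the iterates D^i(a) of a homogeneous a
    have pairwise distinct degrees d + i k. By local finiteness all of them are
    supported in one finite set of monomials, so only finitely many are
    nonzero: D is locally nilpotent ([locally_nilpotent]). The exponential
    series is therefore a finite sum, and exp(D) is the time-1 member of a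
    one-parameter group exp(c D) of automorphisms ([flow_monoid],
    [flow_comp], [exp_derivation_flow]).

    Let S be the diagonal linear automorphism X_i |-> 2^(w_i) X_i. It multiplies
    a homogeneous element of degree d by 2^d, so that S D = t D S with
    t = 2^k ([scale_vars_D]), and hence S exp(c D) = exp(t c D) S
    ([semiconj_flow]). For every c,
      exp(- c D) (S exp(D)) exp(c D) = exp((t (c + 1) - c) D) S,
    and since t <> 1 the choice c = t / (1 - t) makes the exponent vanish.
    Thus S exp(D) is conjugate to the linear automorphism S. *)

(** * Iterates of a linear endomorphism *)

Section IteratedLinearMap.
Variables (K : pzRingType) (V : lmodType K) (D : {linear V -> V}).

Fact iter_linear i : linear (iter i D).
Proof. by elim: i => [//|i IH] c p q /=; rewrite IH linearP. Qed.
HB.instance Definition _ i :=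
  GRing.isLinear.Build K V V _ (iter i D) (iter_linear i).

Lemma iter_eq0 N i a : iter N D a = 0 -> (N <= i)%N -> iter i D a = 0.
Proof. by move=> DN /subnK <-; rewrite iterD DN linear0. Qed.

End IteratedLinearMap.

(** * The one-parameter group of a locally nilpotent derivation *)

Section Flow.
Variables (K : numFieldType) (A : comAlgType K) (D : {linear A -> A}).
Hypothesis derD : derivation D.

(** With the factor 1 / i!, Leibniz' formula becomes the product formula for the
    coefficients of polynomials ([divpow_mul]), and the composition rule
    [divpow_comp] the formula [coef_nderivn]. *)
Definition divpow i (a : A) : A := (i`!%:R)^-1 *: iter i D a.

Fact divpow_linear i : linear (divpow i).
Proof.
by move=> c p q; rewrite /divpow linearP scalerDr !scalerA [_ * c]mulrC.
Qed.
HB.instance Definition _ i :=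
  GRing.isLinear.Build K A A _ (divpow i) (divpow_linear i).

Lemma divpow0 a : divpow 0 a = a.
Proof. by rewrite /divpow fact0 invr1 scale1r. Qed.

Lemma D_divpow i a : D (divpow i a) = i.+1%:R *: divpow i.+1 a.
Proof.
by rewrite /divpow linearZ /= scalerA factS natrM invfM mulrA mulfV ?mul1r.
Qed.

Lemma divpow_comp i j a :
  divpow i (divpow j a) = divpow (i + j) a *+ 'C(i + j, i).
Proof.
rewrite {1}/divpow linearZ /= scalerA -iterD -[RHS](scaler_nat (R := K)).
rewrite /divpow scalerA.
congr (_ *: _).
rewrite -(bin_fact (leq_addr j i)) addKn !natrM !invfM.
by rewrite mulVKf // pnatr_eq0 -lt0n bin_gt0 leq_addr.
Qed.

Lemma divpow_mul m p q :
  divpow m (p * q) = \sum_(i < m.+1) divpow i p * divpow (m - i) q.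
Proof.
elim: m => [|m IHm]; first by rewrite big_ord1 !divpow0.
have m1_neq0 : (m.+1%:R : K) != 0 by rewrite pnatr_eq0.
(* Multiplied by m + 1, the claim is D applied to the induction hypothesis,
   once the factor m + 1 on the right is split as i + (m + 1 - i) in the i-th
   term. *)
apply: (scalerI m1_neq0).
rewrite -D_divpow IHm raddf_sum /= scaler_sumr.
under eq_bigr => i _ do
  rewrite (proj2 derD) !D_divpow -scalerAl -[X in _ + X]scalerAr.
rewrite big_split /= [RHS](eq_bigr (fun i : 'I_m.+2 =>
   (i%:R : K) *: (divpow i p * divpow (m.+1 - i) q)
   + ((m.+1 - i)%:R : K) *: (divpow i p * divpow (m.+1 - i) q))); last first.
  by move=> i _; rewrite -scalerDl -natrD subnKC // -ltnS.
rewrite big_split /=; congr (_ + _).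
  by rewrite [RHS]big_ord_recl scale0r add0r.
rewrite [RHS]big_ord_recr /= subnn scale0r addr0.
by apply: eq_bigr => i _; rewrite subSn // -ltnS.
Qed.

Hypothesis nilD : forall a, exists N, iter N D a == 0.

(** The polynomial sum_i D^i(a) / i! 'X^i over A, that is exp('X D)(a). Working
    with it turns multiplicativity and the group law of the exponential into
    the product and Taylor formulas for polynomials. *)
Definition taylor a : {poly A} := \poly_(i < ex_minn (nilD a)) divpow i a.

Lemma coef_taylor a i : (taylor a)`_i = divpow i a.
Proof.
rewrite coef_poly; case: ex_minnP => N /eqP DN _; case: ltnP => // leNi.
by rewrite /divpow (iter_eq0 DN leNi) scaler0.
Qed.

Lemma taylorD p q : taylor (p + q) = taylor p + taylor q.
Proof. by apply/polyP => i; rewrite coefD !coef_taylor linearD. Qed.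

Lemma taylorZ c p : taylor (c *: p) = (c%:A)%:P * taylor p.
Proof. by apply/polyP => i; rewrite coefCM !coef_taylor linearZ mulr_algl. Qed.

Lemma taylorM p q : taylor (p * q) = taylor p * taylor q.
Proof.
apply/polyP => i; rewrite coefM coef_taylor divpow_mul.
by under eq_bigr => j _ do rewrite -!coef_taylor.
Qed.

Lemma derivation1 : D 1 = 0.
Proof.
by apply: (addIr (D 1)); rewrite add0r -{3}[1]mulr1 (proj2 derD) mulr1 mul1r.
Qed.

Lemma taylor1 : taylor 1 = 1.
Proof.
apply/polyP => -[|i]; rewrite coef_taylor coef1 ?divpow0 //.
by rewrite /divpow iterSr derivation1 linear0 scaler0.
Qed.

(** exp(c D). *)
Definition flow (c : K) (a : A) : A := (taylor a).[c%:A].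

Lemma flowE N c a : iter N D a = 0 ->
  flow c a = \sum_(i < N) c ^+ i *: divpow i a.
Proof.
move=> DN; rewrite /flow (@horner_coef_wide _ N); last first.
  apply/leq_sizeP => i leNi.
  by rewrite coef_taylor /divpow (iter_eq0 DN leNi) scaler0.
apply: eq_bigr => i _.
by rewrite coef_taylor exprZn expr1n mulr_algr.
Qed.

Lemma flow_linear c : linear (flow c).
Proof.
move=> x p q; rewrite /flow taylorD taylorZ hornerD hornerM hornerC.
by rewrite mulr_algl.
Qed.

Lemma flow_monoid c : monoid_morphism (flow c).
Proof.
by split=> [|p q]; rewrite /flow ?taylor1 ?hornerC // taylorM hornerM.
Qed.

Lemma flow0 a : flow 0 a = a.
Proof. by rewrite /flow scale0r horner_coef0 coef_taylor divpow0. Qed.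

(** This identifies [taylor (flow c a)] with the Taylor expansion of the
    polynomial [taylor a] at the point c. *)
Lemma divpow_flow i c a : divpow i (flow c a) = (taylor a)^`N(i).[c%:A].
Proof.
have [N /eqP DN] := nilD a.
rewrite (flowE c DN) linear_sum (@horner_coef_wide _ N) /=; last first.
  apply/leq_sizeP => j leNj; rewrite coef_nderivn coef_taylor /divpow.
  by rewrite (iter_eq0 DN (leq_trans leNj (leq_addl i j))) scaler0 mul0rn.
apply: eq_bigr => j _; rewrite [divpow i _]linearZ /= coef_nderivn coef_taylor.
by rewrite divpow_comp exprZn expr1n mulr_algr.
Qed.

(** Taylor's formula at c for the polynomial [taylor a], evaluated at c + d. *)
Lemma flow_comp c d a : flow d (flow c a) = flow (c + d) a.
Proof.
have [N /eqP DN] := nilD (flow c a).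
have [M /eqP DM] := nilD a.
have DMN : iter (maxn M N) D (flow c a) = 0 := iter_eq0 DN (leq_maxr _ _).
rewrite (flowE d DMN) /flow scalerDl (@nderiv_taylor_wide _ (maxn M N)).
- by apply: eq_bigr => i _; rewrite divpow_flow exprZn expr1n mulr_algr.
- exact: mulrC.
apply/leq_sizeP => i leMi; rewrite coef_taylor /divpow.
by rewrite (iter_eq0 DM (leq_trans (leq_maxl _ _) leMi)) scaler0.
Qed.

Lemma flowK c : cancel (flow c) (flow (- c)).
Proof. by move=> a; rewrite flow_comp subrr flow0. Qed.

Lemma flowNK c : cancel (flow (- c)) (flow c).
Proof. by move=> a; rewrite flow_comp addNr flow0. Qed.

(** S D S^-1 = t D implies S exp(c D) S^-1 = exp(t c D); stated without
    inverting S. *)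
Lemma semiconj_flow (S : {linear A -> A}) (t c : K) a :
  (forall b, S (D b) = t *: D (S b)) ->
  S (flow c a) = flow (t * c) (S a).
Proof.
move=> SD.
have SDi i b : S (iter i D b) = t ^+ i *: iter i D (S b).
  elim: i => [|i IHi] /=; first by rewrite scale1r.
  by rewrite SD IHi linearZ /= scalerA -exprS.
have [N /eqP DN] := nilD a.
have [M /eqP DM] := nilD (S a).
rewrite (flowE c (iter_eq0 DN (leq_maxl N M))).
rewrite (flowE _ (iter_eq0 DM (leq_maxr N M))) linear_sum.
apply: eq_bigr => i _; rewrite /divpow !linearZ /= SDi !scalerA exprMn.
by rewrite mulrAC [c ^+ i * _]mulrC [in RHS]mulrC.
Qed.

End Flow.

(** The partial sums of the series are eventually constant, and limits in K are
    unique. *)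
Lemma exp_derivation_flow (K : numFieldType) n
    (D : {linear mpoly n K -> mpoly n K})
    (nilD : forall a, exists N, iter N D a == 0) :
  exp_derivation D =1 flow nilD 1.
Proof.
move=> a.
have flow_lim m : (series
    (fun i : nat => (i`!%:R)^-1 * mcoeff m (iter i D a) : K)
    @ \oo --> mcoeff m (flow nilD 1 a))%classic.
  have [N /eqP DN] := nilD a.
  apply: cvg_near_cst; exists N => // M /= leNM.
  rewrite (flowE nilD 1 (iter_eq0 DN leNM)) raddf_sum /= /series /=.
  rewrite big_mkord; apply: eq_bigr => i _.
  by rewrite expr1n scale1r mcoeffZ.
rewrite /exp_derivation; case: xgetP => [b _ b_lim|]; last first.
  by move/(_ (flow nilD 1 a)); case.
apply/mpolyP => m.
exact: (cvg_unique _ (b_lim m) (flow_lim m)).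
Qed.

(** * Local nilpotency of locally finite homogeneous derivations *)

Section LocallyNilpotent.
Variables (R : realFieldType) (K : fieldType) (n : nat) (w : 'I_n -> R) (k : R).
Variable D : {linear mpoly n K -> mpoly n K}.
Hypotheses (finD : locally_finite D) (k_neq0 : k != 0).
Hypothesis homD : homogeneous_of_degree w k D.

Lemma iter_homogeneous d p i : whomogeneous w d p ->
  whomogeneous w (d + i%:R * k) (iter i D p).
Proof.
move=> hp; elim: i => [|i IHi]; first by rewrite mul0r addr0.
by rewrite mulrSr mulrDl mul1r addrA; apply: homD.
Qed.

(** The iterates lie in the span of finitely many polynomials, whose supports
    together cover theirs. *)
Lemma iterates_support a :
  exists s : seq (multinom n), forall i, {subset msupp (iter i D a) <= s}.
Proof.
have [r [b span_b]] := finD a.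
exists (flatten [seq msupp (b j) | j <- enum 'I_r]) => i m m_in.
have [r' [c [v [v_b Dia]]]] : lspan (range b) (iter i D a).
  rewrite -span_b; exists 1%N, (fun=> 1), (fun=> iter i D a); split=> [_|].
    by exists i.
  by rewrite big_ord1 scale1r.
move: m_in; rewrite Dia => m_in; apply/flattenP.
have [j m_j] : exists j, m \in msupp (v j).
  apply/existsP; apply: contraTT m_in => /existsPn v0.
  rewrite mcoeff_msupp negbK raddf_sum /= big1 // => j _.
  by rewrite mcoeffZ (memN_msupp_eq0 (v0 j)) mulr0.
have [l _ vl] := v_b j.
exists (msupp (b l)); last by rewrite vl.
by apply: (map_f (fun j => msupp (b j))); rewrite mem_enum.
Qed.

(** If no iterate vanished, the infinitely many degrees d + i k would all occur
    among those of the finitely many monomials of [iterates_support]. *)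
Lemma locally_nilpotent_homogeneous d p : whomogeneous w d p ->
  exists N, iter N D p == 0.
Proof.
move=> hp; have [s s_supp] := iterates_support p.
apply: contrapT => nilN.
have : (size [seq (d + i%:R * k)%R | i <- iota 0 (size s).+1]
        <= size (map (wdegree w) s))%N.
  apply: uniq_leq_size => [|_ /mapP[i _ ->]].
    rewrite map_inj_uniq ?iota_uniq // => i j /addrI /(mulIf k_neq0) /eqP.
    by rewrite eqr_nat => /eqP.
  have [m m_in] : exists m, m \in msupp (iter i D p).
    case E: (msupp (iter i D p)) => [|m t]; last by exists m; rewrite inE eqxx.
    by case: nilN; exists i; rewrite -msupp_eq0 E.
  by rewrite -(iter_homogeneous hp m_in) map_f // (s_supp i).
by rewrite !size_map size_iota ltnn.
Qed.

Lemma whomogeneousX m : whomogeneous w (wdegree w m) (mpolyX K m).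
Proof. by move=> m'; rewrite msuppX inE => /eqP ->. Qed.

Lemma locally_nilpotent a : exists N, iter N D a == 0.
Proof.
elim/mpolyind: a => [|c m p _ _ [N /eqP DN]].
  by exists 0%N.
have [M /eqP DM] := locally_nilpotent_homogeneous (whomogeneousX (m:=m)).
exists (maxn M N); rewrite linearP /=.
rewrite (iter_eq0 DM (leq_maxl M N)) (iter_eq0 DN (leq_maxr M N)).
by rewrite scaler0 addr0.
Qed.

End LocallyNilpotent.

(** * Diagonal linear automorphisms *)

Section DiagonalAutomorphism.
Variables (K : fieldType) (n : nat) (l : 'I_n -> K).
Hypothesis l_neq0 : forall i, l i != 0.

Definition scale_vars (u : 'I_n -> K) : mpoly n K -> mpoly n K :=
  comp_mpoly [tuple u i *: mpolyX K (mnm1 i) | i < n].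

Lemma scale_varsX u m :
  scale_vars u (mpolyX K m) = (\prod_(i < n) u i ^+ m i) *: mpolyX K m.
Proof.
rewrite /scale_vars comp_mpolyX [mpolyX K m in RHS]mpolyXE_id -scaler_prod.
by apply: eq_bigr => i _; rewrite tnth_mktuple exprZn.
Qed.

Fact scale_vars_linear u : linear (scale_vars u).
Proof. exact: (@linearP _ _ _ _ (comp_mpoly _)). Qed.
HB.instance Definition _ u := GRing.isLinear.Build K (mpoly n K) (mpoly n K) _
  (scale_vars u) (scale_vars_linear u).

Lemma scale_varsK u v : (forall i, u i * v i = 1) ->
  cancel (scale_vars u) (scale_vars v).
Proof.
move=> uv p; elim/mpolyind: p => [|c m p _ _ IHp].
  by rewrite /scale_vars !linear0.
rewrite !linearP /= IHp !scale_varsX.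
rewrite linearZ /= scale_varsX; congr (_ *: _ + _).
rewrite scalerA -big_split big1 ?scale1r // => i _ /=.
by rewrite -exprMn uv expr1n.
Qed.

Lemma scale_vars_GL : GL (scale_vars l).
Proof.
have lV i : l i * (l i)^-1 = 1 by rewrite mulfV.
have Vl i : (l i)^-1 * l i = 1 by rewrite mulVf.
split; first split.
- exact: scale_vars_linear.
- by split=> [|p q]; rewrite /scale_vars ?rmorph1 ?rmorphM.
- by exists (scale_vars (fun i => (l i)^-1)); apply: scale_varsK.
move=> i; exists (fun j => (i == j)%:R * l i).
rewrite scale_varsX (bigD1 i) //= big1 => [|j ne_ij]; last first.
  by rewrite mnm1E eq_sym (negPf ne_ij).
rewrite (bigD1 i) //= mnm1E eqxx mul1r mulr1 big1 ?addr0 // => j ne_ij.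
by rewrite eq_sym (negPf ne_ij) mul0r scale0r.
Qed.

Lemma GA_comp (F G : mpoly n K -> mpoly n K) : GA F -> GA G -> GA (F \o G).
Proof.
move=> [Flin [F1 FM] Fbij] [Glin [G1 GM] Gbij]; split; last exact: bij_comp.
  by move=> c p q /=; rewrite Glin Flin.
by split=> [|p q] /=; rewrite ?G1 ?F1 // GM FM.
Qed.

End DiagonalAutomorphism.

(** * Linearization of the shifted exponential *)

(** The diagonal automorphism is built from a character chi of the additive
    group of degrees that is nontrivial at k; over the complex numbers,
    x |-> 2^x is one. *)
Section ShiftedExponential.
Variables (K : numFieldType) (R : realFieldType) (n : nat).
Variables (w : 'I_n -> R) (k : R).
Variables (D : {linear mpoly n K -> mpoly n K}) (chi : R -> K).
Hypotheses (derD : derivation D) (finD : locally_finite D).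
Hypotheses (k_neq0 : k != 0) (homD : homogeneous_of_degree w k D).
Hypotheses (chi0 : chi 0 = 1) (chiD : {morph chi : x y / x + y >-> x * y}).
Hypothesis chi_k : chi k != 1.

Local Notation S := (scale_vars (chi \o w)).

Lemma scale_vars_homogeneous d p : whomogeneous w d p -> S p = chi d *: p.
Proof.
move=> hp; rewrite /scale_vars comp_mpolyEX [in RHS](mpolyE p) scaler_sumr.
apply: eq_big_seq => m /hp <-.
rewrite -/(scale_vars _ _) scale_varsX !scalerA mulrC; congr (_ * _ *: _).
rewrite /wdegree (big_morph chi chiD chi0); apply: eq_bigr => i _ /=.
elim: (m i) => [|j IHj]; first by rewrite mul0r chi0.
by rewrite exprS IHj -chiD -natr1 mulrDl mul1r addrC.
Qed.

(** Both sides multiply the image under D of a monomial of degree d by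
    chi (d + k) = chi k * chi d, since this image has degree d + k. *)
Lemma scale_vars_D p : S (D p) = chi k *: D (S p).
Proof.
elim/mpolyind: p => [|c m p _ _ IHp].
  have D0 : D 0 = 0 by apply: linear0.
  by rewrite D0 /scale_vars linear0 D0 scaler0.
have homX : whomogeneous w (wdegree w m) (mpolyX K m) by apply: whomogeneousX.
rewrite !linearP /= IHp; congr (_ *: _ + _).
rewrite (scale_vars_homogeneous (homD homX)) (scale_vars_homogeneous homX).
by rewrite [D (_ *: _)]linearZ /= scalerA chiD mulrC.
Qed.

Lemma exp_shifted_linearizable : shifted_linearizable (exp_derivation D).
Proof.
have nilD : forall a, exists N, iter N D a == 0.
  exact: (locally_nilpotent finD k_neq0 homD).
have flow_GA c : GA (flow nilD c).
  split; [exact: flow_linear | exact: flow_monoid |].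
  by exists (flow nilD (- c)); [apply: flowK | apply: flowNK].
have -> : exp_derivation D = flow nilD 1.
  by apply/funext => a; apply: exp_derivation_flow.
have chi_neq0 x : chi x != 0.
  apply: contraNneq (oner_neq0 K) => x0.
  by rewrite -chi0 -(addrN x) chiD x0 mul0r.
have S_GL : GL S by apply: scale_vars_GL => i; apply: chi_neq0.
have t1 : 1 - chi k != 0 by rewrite subr_eq0 eq_sym.
split=> //; exists S; split=> //; split.
  by apply: GA_comp => //; case: S_GL.
(* c solves chi k * (c + 1) = c. *)
pose c := chi k / (1 - chi k).
exists (flow nilD c), (flow nilD (- c)), S.
split=> //; [exact: flowK | exact: flowNK |] => p /=.
rewrite flow_comp /scale_vars (semiconj_flow nilD _ _ scale_vars_D).
rewrite flow_comp // [X in flow _ X](_ : _ = 0) ?flow0 //.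
by rewrite /c; field.
Qed.

End ShiftedExponential.

Local Open Scope complex_scope.

Theorem theorem2p4 (R : realType) (n : nat)
  (D : mpoly n R[i] -> mpoly n R[i]) (w : 'I_n -> R) (k : R) :
  (1 <= n)%N ->
  derivation D ->
  locally_finite D ->
  k != 0 ->
  homogeneous_of_degree w k D ->
  shifted_linearizable (exp_derivation D).
Proof.
move=> _ derD finD k_neq0 homD.
pose D_isLinear :=
  GRing.isLinear.Build R[i] (mpoly n R[i]) (mpoly n R[i]) _ D (proj1 derD).
pose D' : {linear mpoly n R[i] -> mpoly n R[i]} := HB.pack D D_isLinear.
apply: (@exp_shifted_linearizable _ R n w k D' (fun x => (2 `^ x)%:C)) => //.
- by rewrite powRr0.
- by move=> x y; rewrite powRD ?rmorphM // pnatr_eq0 implybT.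
rewrite -(rmorph1 (real_complex R)) (inj_eq (@complexI R)) powR_eq1.
by rewrite ltNge ler0n (negPf k_neq0) pnatr_eq1.
Qed.
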